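(* Let $n\in\{2,3\}$ and let $(M^n,\mathcal T)$ be a closed triangulated $n$-manifold with vertices $1,\dots,N$ (with a fixed weight $\Phi:\mathcal T_1\to[0,\frac{\pi}{2}]$ on edges if $n=2$). Let $\alpha,\beta\in\mathbb R$ and let $r(t)$ be a solution, in $\mathbb R^N_{>0}$ if $n=2$ and in $\mathfrak M_{\mathcal T}$ if $n=3$, of the $(\alpha,\beta)$-flow $$\frac{dr_i}{dt}=s_\alpha r_i^{\beta}-K_i r_i^{\beta-\alpha},\qquad i=1,\dots,N,\qquad s_\alpha=\frac{\sum_{i=1}^N K_i r_i^{n-2}}{\sum_{i=1}^N r_i^{\alpha+n-2}}.$$ Let $\delta=\alpha-\beta+n-1$. If $\delta\ne0$, then $\sum_{i=1}^N r_i^{\delta}(t)$ is constant in $t$ along the flow. If $\delta=0$, then $\prod_{i=1}^N r_i(t)$ is constant in $t$ along the flow.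
   Context: A triangulated $n$-manifold $(M^n,\mathcal T)$ is a closed $n$-manifold with a triangulation $\mathcal T=\{\mathcal T_0,\dots,\mathcal T_n\}$, $\mathcal T_i$ being the set of $i$-simplices; $N$ is the number of vertices. Case $n=2$ (Thurston's circle packing metrics). A weight $\Phi:\mathcal T_1\to[0,\frac{\pi}{2}]$ is fixed. A circle packing metric is a map $r:\mathcal T_0\to(0,+\infty)$, identified with $r\in\mathbb R^N_{>0}=(0,+\infty)^N$. Each edge $\{ij\}$ gets length $l_{ij}=\sqrt{r_i^2+r_j^2+2r_ir_j\cos\Phi_{ij}}$; it is known (Thurston) that the three lengths on each face satisfy the triangle inequalities, so each face is realized as a Euclidean triangle. With $\theta_i^{jk}$ the inner angle at vertex $i$ of the triangle $\{ijk\}$, the discrete Gauss curvature is $K_i=2\pi-\sum_{\{ijk\}\in\mathcal T_2}\theta_i^{jk}$, summed over all triangles having $i$ as a vertex. Case $n=3$ (Cooper–Rivin ball packing metrics). For $r\in\mathbb R^N_{>0}$ each edge $\{ij\}$ gets length $l_{ij}=r_i+r_j$. The map $r$ is a (non-degenerate) ball packing metric if for each $\{i,j,k,l\}\in\mathcal T_3$ the six lengths are the edge lengths of a non-degenerate Euclidean tetrahedron, equivalently $$Q_{ijkl}=\Big(\tfrac1{r_i}+\tfrac1{r_j}+\tfrac1{r_k}+\tfrac1{r_l}\Big)^2-2\Big(\tfrac1{r_i^2}+\tfrac1{r_j^2}+\tfrac1{r_k^2}+\tfrac1{r_l^2}\Big)>0.$$ $\mathfrak M_{\mathcal T}=\{r\in\mathbb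 R^N_{>0}: Q_{ijkl}>0\ \text{for all}\ \{i,j,k,l\}\in\mathcal T_3\}$. With $\alpha_{ijkl}$ the solid angle at vertex $i$ of the Euclidean tetrahedron $\{i,j,k,l\}$, the discrete scalar curvature is $K_i=4\pi-\sum_{\{i,j,k,l\}\in\mathcal T_3}\alpha_{ijkl}$, summed over all tetrahedra having $i$ as a vertex. *)

(* Defs.v *)
From HB Require Import structures.
From mathcomp Require Export all_boot all_order all_algebra.
From mathcomp Require Export all_classical all_reals all_analysis.

Set Implicit Arguments.
Unset Strict Implicit.
Unset Printing Implicit Defensive.

Import Order.TTheory GRing.Theory Num.Theory.
Import numFieldNormedType.Exports.

Local Open Scope classical_set_scope.
Local Open Scope ring_scope.

(** * Closed manifolds and triangulations *)

Definition homeomorphic_sets (X Y : topologicalType) (A : set X) (B : set Y) :=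
  exists f : X -> Y, exists g : Y -> X,
    [/\ {homo f : x / A x >-> B x} /\ {homo g : y / B y >-> A y},
        (forall x, A x -> g (f x) = x) /\ (forall y, B y -> f (g y) = y),
        {within A, continuous f} & {within B, continuous g}].

Definition locally_euclidean (R : realType) (n : nat) (M : topologicalType) :=
  forall x : M, exists U : set M, exists V : set 'rV[R]_n,
    [/\ open U, U x, open V & homeomorphic_sets U V].

Definition closed_manifold (R : realType) (n : nat) (M : topologicalType) :=
  [/\ hausdorff_space M, @second_countable M, compact [set: M]
    & locally_euclidean R n M].

(* Finite abstract simplicial complexes with vertex set 'I_N, given by their
   nonempty simplices; every element of 'I_N is an actual vertex. *)
Definition simplicial_complex (N : nat) (T : {set {set 'I_N}}) :=
  [/\ finset.set0 \notin T,
      (forall i : 'I_N, [set i]%SET \in T)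
    & (forall s t : {set 'I_N},
         s \in T -> t \subset s -> t != finset.set0 -> t \in T)].

Definition simplices (N : nat) (T : {set {set 'I_N}}) (k : nat) :
    {set {set 'I_N}} :=
  [set s in T | #|s| == k.+1]%SET.

(* Barycentric coordinates: vertex i sits at the i-th basis vector of R^N. *)
Definition geometric_realization (R : realType) (N : nat)
    (T : {set {set 'I_N}}) : set 'rV[R]_N :=
  [set x | [/\ (forall i, 0 <= x ord0 i), \sum_i x ord0 i = 1
             & [set i | x ord0 i != 0]%SET \in T]].

Definition triangulated_manifold (R : realType) (n : nat) (M : topologicalType)
    (N : nat) (T : {set {set 'I_N}}) :=
  [/\ closed_manifold R n M, simplicial_complex T
    & homeomorphic_sets (@geometric_realization R N T) [set: M]].

(** * Euclidean geometry *)

(* The library norm on 'rV[R]_n is the sup norm, hence these. *)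
Definition dotp (R : realType) (n : nat) (u v : 'rV[R]_n) : R :=
  \sum_i u ord0 i * v ord0 i.

Definition enorm (R : realType) (n : nat) (u : 'rV[R]_n) : R :=
  Num.sqrt (dotp u u).

Definition realizes (R : realType) (n N : nat) (l : 'I_N -> 'I_N -> R)
    (s : {set 'I_N}) : set ('I_N -> 'rV[R]_n) :=
  [set p | forall i j, i \in s -> j \in s -> i != j ->
             enorm (p i - p j) = l i j].

(* A placement in R^n of the vertices of s with the prescribed edge lengths
   (junk when there is none). It is unique up to isometry, so that the angles
   below do not depend on the choice. *)
Definition realization (R : realType) (n N : nat) (l : 'I_N -> 'I_N -> R)
    (s : {set 'I_N}) : 'I_N -> 'rV[R]_n :=
  xget (fun=> 0) (@realizes R n N l s).

Definition inner_angle (R : realType) (n : nat) (p q1 q2 : 'rV[R]_n) : R :=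
  acos (dotp (q1 - p) (q2 - p) / (enorm (q1 - p) * enorm (q2 - p))).

Definition volume3 (R : realType) (A : set 'rV[R]_3) : \bar R :=
  ((@lebesgue_measure R \x @lebesgue_measure R) \x @lebesgue_measure R)%E
    [set x : R * R * R | A (\row_k [:: x.1.1; x.1.2; x.2]`_k)].

(* Translated so that the apex p is at the origin. *)
Definition tetra_cone (R : realType) (p q1 q2 q3 : 'rV[R]_3) : set 'rV[R]_3 :=
  [set v | exists a b c : R, [/\ 0 <= a, 0 <= b, 0 <= c
     & v = a *: (q1 - p) + b *: (q2 - p) + c *: (q3 - p)]].

(* The area of a region of the unit sphere is 3 times the volume of the part
   of the unit ball lying over that region. *)
Definition solid_angle (R : realType) (p q1 q2 q3 : 'rV[R]_3) : R :=
  3 * fine (volume3 (tetra_cone p q1 q2 q3 `&` [set v | enorm v <= 1])).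

(** * Discrete curvatures *)

Definition cp_length (R : realType) (N : nat) (Phi : {set 'I_N} -> R)
    (r : 'I_N -> R) (i j : 'I_N) : R :=
  Num.sqrt (r i ^+ 2 + r j ^+ 2 + 2 * r i * r j * cos (Phi [set i; j]%SET)).

Definition cp_angle (R : realType) (N : nat) (Phi : {set 'I_N} -> R)
    (r : 'I_N -> R) (i j k : 'I_N) : R :=
  let p := realization 2 (cp_length Phi r) [set i; j; k]%SET in
  inner_angle (p i) (p j) (p k).

(* The order j < k makes each triangle {i, j, k} count once. *)
Definition gauss_curvature (R : realType) (N : nat) (T : {set {set 'I_N}})
    (Phi : {set 'I_N} -> R) (r : 'I_N -> R) (i : 'I_N) : R :=
  2 * pi - \sum_(j < N)
             \sum_(k < N | (j < k)%N && ([set i; j; k]%SET \in simplices T 2))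
               cp_angle Phi r i j k.

Definition bp_length (R : realType) (N : nat) (r : 'I_N -> R) (i j : 'I_N) : R :=
  r i + r j.

Definition bp_Q (R : realType) (N : nat) (r : 'I_N -> R) (s : {set 'I_N}) : R :=
  (\sum_(i in s) (r i)^-1) ^+ 2 - 2 * \sum_(i in s) (r i ^+ 2)^-1.

Definition bp_angle (R : realType) (N : nat) (r : 'I_N -> R)
    (i j k l : 'I_N) : R :=
  let p := realization 3 (bp_length r) [set i; j; k; l]%SET in
  solid_angle (p i) (p j) (p k) (p l).

Definition scalar_curvature (R : realType) (N : nat) (T : {set {set 'I_N}})
    (r : 'I_N -> R) (i : 'I_N) : R :=
  4 * pi - \sum_(j < N) \sum_(k < N)
             \sum_(l < N | [&& (j < k)%N, (k < l)%N
                         & [set i; j; k; l]%SET \in simplices T 3])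
               bp_angle r i j k l.

(* Meaningful for n = 2 and n = 3 only; Phi is ignored when n = 3. *)
Definition curvature (R : realType) (n N : nat) (T : {set {set 'I_N}})
    (Phi : {set 'I_N} -> R) (r : 'I_N -> R) (i : 'I_N) : R :=
  if n == 2%N then gauss_curvature T Phi r i else scalar_curvature T r i.

Definition admissible_metrics (R : realType) (n N : nat) (T : {set {set 'I_N}}) :
    set ('I_N -> R) :=
  [set r | (forall i, 0 < r i) /\
           (n = 3%N -> forall s, s \in simplices T 3 -> 0 < bp_Q r s)].

(** * The (alpha, beta)-flow *)

Definition s_alpha (R : realType) (n N : nat) (T : {set {set 'I_N}})
    (Phi : {set 'I_N} -> R) (alpha : R) (r : 'I_N -> R) : R :=
  (\sum_i curvature n T Phi r i * r i `^ (n%:R - 2))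
  / (\sum_i r i `^ (alpha + n%:R - 2)).

Definition flow_field (R : realType) (n N : nat) (T : {set {set 'I_N}})
    (Phi : {set 'I_N} -> R) (alpha beta : R) (r : 'I_N -> R) (i : 'I_N) : R :=
  s_alpha n T Phi alpha r * r i `^ beta
  - curvature n T Phi r i * r i `^ (beta - alpha).

(* Derivative relative to J: two-sided inside J, one-sided at an endpoint of J
   that belongs to J. *)
Definition has_derivative_within (R : realType) (J : interval R) (f : R -> R)
    (t d : R) :=
  (f u - f t) / (u - t) @[u --> within [set` J] t^'] --> d.

Definition flow_solution (R : realType) (n N : nat) (T : {set {set 'I_N}})
    (Phi : {set 'I_N} -> R) (alpha beta : R) (J : interval R)
    (r : R -> 'I_N -> R) :=
  forall t, t \in J -> admissible_metrics n T (r t) /\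
    forall i, has_derivative_within J (fun u => r u i) t
                (flow_field n T Phi alpha beta (r t) i).

(* Main.v *)
Require Import Defs.
From mathcomp Require Import ring.

Import Order.TTheory GRing.Theory Num.Theory.
Import numFieldNormedType.Exports.
Local Open Scope classical_set_scope.
Local Open Scope ring_scope.

(** Along the flow, sum_i r_i^delta has derivative delta * sum_i r_i^(delta-1) r_i', and ln of
    prod_i r_i has derivative sum_i r_i^(-1) r_i', which is the same sum at delta = 0. Since delta -
    1 = alpha - beta + n - 2, inserting the flow equation turns sum_i r_i^(delta-1) r_i' into
    s_alpha * sum_i r_i^(alpha+n-2) - sum_i K_i r_i^(n-2), which is 0 by the choice of s_alpha
    ([sum_powR_flow_field_eq0]). [sum_flow_const] passes from zero derivative to constancy by the
    mean value theorem. *)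

(** Write f u = f t + quotient * (u - t), where the quotient has a finite limit. This supplies
    continuity at endpoints of J, where the derivative is only one-sided. *)
Lemma has_derivative_within_cvg (R : realType) (J : interval R) (f : R -> R)
    (t d : R) :
  has_derivative_within J f t d ->
  f u @[u --> within [set` J] (nbhs t)] --> f t.
Proof.
move=> hd.
have hsub : (u - t) @[u --> within [set` J] t^'] --> (0 : R).
  rewrite -(subrr t); apply: cvgB; last exact: cvg_cst.
  apply: cvg_trans (nbhs_dnbhs (x := t)).
  exact: cvg_within.
have hlim : f t + (f u - f t) / (u - t) * (u - t)
    @[u --> within [set` J] t^'] --> f t.
  rewrite -[X in _ --> X]addr0 -(mulr0 d).
  by apply: cvgD; [exact: cvg_cst | exact: cvgM].
move=> A hA.
have near_t : \forall u \near t, u != t -> u \in J ->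
    A (f t + (f u - f t) / (u - t) * (u - t)) := hlim _ hA.
change (\forall u \near t, u \in J -> A (f u)).
apply: filterS near_t => u hu uJ.
(* The punctured filter says nothing at u = t, but there A (f t) holds because A is a neighbourhood
   of f t. *)
have [->|ut] := eqVneq u t; first exact: nbhs_singleton.
have := hu ut uJ; rewrite /= divfK ?subr_eq0//.
by rewrite addrC subrK.
Qed.

(** Near an interior point the restriction to J is vacuous; the rest is the substitution u = h +
    t. *)
Lemma has_derivative_within_is_derive (R : realType) (J : interval R)
    (f : R -> R) (t d : R) :
  [set` J]° t -> has_derivative_within J f t d -> is_derive t 1 f d.
Proof.
move=> tJ hd.
have lim_quotient : h^-1 *: ((f \o shift t) (h *: 1) - f t) @[h --> 0^'] --> d.
  move=> A hA.
  have near_t : \forall u \near t, u != t -> u \in J ->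
    A ((f u - f t) / (u - t)) := hd _ hA.
  have {}near_t : \forall u \near t, u != t -> A ((f u - f t) / (u - t)).
    by apply: filterS2 near_t tJ => u hu uJ ut; exact: hu.
  have shift_cvg : h + t @[h --> (0 : R)] --> t.
    rewrite -[X in _ --> X]add0r.
    by apply: cvgD; [exact: cvg_id | exact: cvg_cst].
  have near_0 : \forall h \near (0 : R), h + t != t ->
    A ((f (h + t) - f t) / (h + t - t)) := shift_cvg _ near_t.
  change (\forall h \near (0 : R), h != 0 ->
    A (h^-1 *: ((f \o shift t) (h *: 1) - f t))).
  apply: filterS near_0 => h hu h0.
  have := hu; rewrite /= -subr_eq0 addrK => /(_ h0).
  by rewrite mulrC /GRing.scale /= mulr1.
apply: DeriveDef; last exact/cvg_lim.
by apply/cvg_ex; exists d.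
Qed.

Lemma is_derive_sum_comp (R : realType) (N : nat) (phi : R -> R)
    (r : R -> 'I_N -> R) (t : R) (dphi dr : 'I_N -> R) :
  (forall i, is_derive (r t i) 1 phi (dphi i)) ->
  (forall i, is_derive t 1 (fun u => r u i) (dr i)) ->
  is_derive t 1 (fun u => \sum_i phi (r u i)) (\sum_i dphi i * dr i).
Proof.
move=> hphi hr.
have -> : (fun u => \sum_i phi (r u i)) = \sum_i (phi \o (fun u => r u i)).
  by apply/funext => u; rewrite fct_sumE.
by apply: is_derive_sum => i; apply: is_derive1_comp.
Qed.

(* The normalisation [s_alpha] is exactly what makes this sum vanish; both
   conserved quantities reduce to it, since [r^delta] and [ln r] have
   derivatives proportional to [r^(delta - 1)]. *)
Lemma sum_powR_flow_field_eq0 (R : realType) (n N : nat)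
    (T : {set {set 'I_N}}) (Phi : {set 'I_N} -> R) (alpha beta : R)
    (r : 'I_N -> R) :
  (forall i, 0 < r i) ->
  \sum_i r i `^ (alpha - beta + n%:R - 1 - 1)
         * flow_field n T Phi alpha beta r i = 0.
Proof.
move=> r0.
have pow_add (i : 'I_N) x y : r i `^ x * r i `^ y = r i `^ (x + y).
  by rewrite powRD// (gt_eqF (r0 i)) implybT.
transitivity (\sum_i (s_alpha n T Phi alpha r * r i `^ (alpha + n%:R - 2)
                      - curvature n T Phi r i * r i `^ (n%:R - 2))).
  apply: eq_bigr => i _; rewrite /flow_field mulrBr.
  rewrite mulrCA pow_add [X in _ - X]mulrCA pow_add.
  by congr (_ * _ `^ _ - _ * _ `^ _); ring.
rewrite sumrB -mulr_sumr /s_alpha.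
(* The denominator of [s_alpha] is positive as soon as there is one vertex; for N = 0 all sums are
   empty. *)
case: N T Phi r r0 {pow_add} => [|N] T Phi r r0.
  by rewrite !big_ord0 mulr0 subr0.
rewrite divfK ?subrr// gt_eqF// big_ord_recl ltr_pwDl ?powR_gt0//.
by apply: sumr_ge0 => i _; exact: powR_ge0.
Qed.

(** One statement serves both cases: phi = x^delta with c = delta, and phi = ln with c = 1 when
    delta = 0. *)
Lemma sum_flow_const (R : realType) (n N : nat) (T : {set {set 'I_N}})
    (Phi : {set 'I_N} -> R) (alpha beta : R) (J : interval R)
    (r : R -> 'I_N -> R) (phi : R -> R) (c : R) :
  flow_solution n T Phi alpha beta J r ->
  (forall x : R, 0 < x ->
     is_derive x 1 phi (c * x `^ (alpha - beta + n%:R - 1 - 1))) ->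
  forall t1 t2 : R, t1 \in J -> t2 \in J ->
    \sum_i phi (r t1 i) = \sum_i phi (r t2 i).
Proof.
move=> hr hphi t1 t2.
wlog lt12 : t1 t2 / t1 < t2 => [hw t1J t2J|t1J t2J].
  have [lt12|lt21|->//] := ltgtP t1 t2; first exact: hw.
  by symmetry; exact: hw.
have segJ : `[t1, t2] `<=` [set` J].
  by move=> u /= ut; apply: interval_is_interval ut.
have r_gt0 t i : t \in J -> 0 < r t i by move=> /hr[[]].
have [u /= ut] : exists2 u, u \in `]t1, t2[ &
    \sum_i phi (r t2 i) - \sum_i phi (r t1 i) = 0 * (t2 - t1).
  apply: (MVT (f := fun u => \sum_i phi (r u i)) (df := fun=> 0) lt12).
    move=> u ut.
    have uJ : u \in J by apply: segJ; exact: subset_itv_oo_cc ut.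
    (* A point strictly between t1 and t2 is interior to J, so the derivative there is two-sided. *)
    have uJi : [set` J]° u.
      apply: (filterS (P := `]t1, t2[%classic)); last exact: near_in_itvoo.
      by move=> v /= /subset_itv_oo_cc /segJ.
    have [_ hru] := hr u uJ.
    have sum0 : \sum_i c * r u i `^ (alpha - beta + n%:R - 1 - 1)
                    * flow_field n T Phi alpha beta (r u) i = 0.
      under eq_bigr do rewrite -mulrA.
      by rewrite -mulr_sumr sum_powR_flow_field_eq0 ?mulr0// => i; exact: r_gt0.
    rewrite -[X in is_derive _ _ _ X]sum0.
    apply: is_derive_sum_comp => i; first exact/hphi/r_gt0.
    exact: has_derivative_within_is_derive _ _ _ _ _ uJi (hru i).
  (* The mean value theorem also asks for continuity on the closed segment, whose ends may be
     endpoints of J. *)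
  apply/subspace_continuousP => u ut; have uJ := segJ _ ut.
  apply: cvg_big => [|i _]; first exact: add_continuous.
  have phi_cont : {for r u i, continuous phi}.
    apply/differentiable_continuous/derivable1_diffP.
    by case: (hphi _ (r_gt0 u i uJ)).
  apply: continuous_cvg => //.
  apply: cvg_trans (has_derivative_within_cvg _ _ _ _ _ ((hr u uJ).2 i)).
  by apply: cvg_app; exact: within_subset.
by rewrite mul0r => /subr0_eq.
Qed.

Theorem proposition4p1 (R : realType) (n : nat) (hn : n = 2%N \/ n = 3%N)
    (M : topologicalType) (N : nat) (T : {set {set 'I_N}})
    (hMT : triangulated_manifold R n M T)
    (Phi : {set 'I_N} -> R)
    (hPhi : n = 2%N ->
       forall e : {set 'I_N}, e \in simplices T 1 -> 0 <= Phi e <= pi / 2)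
    (alpha beta : R) (J : interval R) (r : R -> 'I_N -> R)
    (hr : flow_solution n T Phi alpha beta J r) :
  let delta := alpha - beta + n%:R - 1 in
  (delta != 0 ->
     forall t1 t2 : R, t1 \in J -> t2 \in J ->
       \sum_i r t1 i `^ delta = \sum_i r t2 i `^ delta) /\
  (delta = 0 ->
     forall t1 t2 : R, t1 \in J -> t2 \in J ->
       \prod_i r t1 i = \prod_i r t2 i).
Proof.
move=> delta; split=> [_|delta0] t1 t2 t1J t2J.
  exact: (sum_flow_const _ _ _ _ _ _ _ _ _ (fun x => x `^ delta) delta hr
    (@is_derive1_powR R delta) _ _ t1J t2J).
have r_gt0 t i : t \in J -> 0 < r t i by move=> /hr[[]].
have prodE t : t \in J -> \prod_i r t i = expR (\sum_i ln (r t i)).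
  move=> tJ; rewrite expR_sum; apply: eq_bigr => i _.
  by rewrite lnK// posrE r_gt0.
rewrite !prodE//; congr expR.
apply: (sum_flow_const _ _ _ _ _ _ _ _ _ (@ln R) 1 hr _ _ _ t1J t2J) => x x0.
rewrite -/delta delta0 mul1r sub0r powR_inv1 ?ltW//.
exact: is_derive1_ln.
Qed.
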